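(* Let $n\geq 3$ be an integer and let $Q_{2^n}$ be the generalized quaternion group of order $2^n$. Then $$csd(Q_{2^n})=\frac{n^2+(n+1)2^{n-1}}{(n+2^{n-2})^2}.$$ In particular, $csd(Q_{16})=\frac{7}{8}$.
   Context: For a finite group $G$, $L_1(G)$ denotes the set of all cyclic subgroups of $G$ (including the trivial subgroup), and the cyclic subgroup commutativity degree of $G$ is $$csd(G)=\frac{1}{|L_1(G)|^2}\left|\{(H,K)\in L_1(G)^2\mid HK=KH\}\right|,$$ where $HK=\{hk\mid h\in H,\,k\in K\}$ and the equality is an equality of sets. The generalized quaternion group of order $2^n$ is $Q_{2^n}=\langle x,y\mid x^{2^{n-1}}=1,\ y^2=x^{2^{n-2}},\ yxy^{-1}=x^{-1}\rangle$. *)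

(* Defs.v *)
From mathcomp Require Import all_boot all_order all_algebra all_fingroup all_solvable.

Set Implicit Arguments.
Unset Strict Implicit.
Unset Printing Implicit Defensive.

Import GRing.Theory.

Local Open Scope ring_scope.

Definition cyclic_subgroups (gT : finGroupType) (G : {group gT}) :
    {set {group gT}} :=
  [set H in subgroups G | cyclic H].

(* The products below are elementwise products of subsets of gT, so that the
   test is the equality of sets HK = KH. *)
Definition permuting_pairs (gT : finGroupType) (G : {group gT}) :
    {set {group gT} * {group gT}} :=
  [set HK in setX (cyclic_subgroups G) (cyclic_subgroups G)
     | (HK.1 * HK.2 == HK.2 * HK.1 :> {set gT})%g].

Definition csd (gT : finGroupType) (G : {group gT}) : rat :=
  1 / #|cyclic_subgroups G|%:R ^+ 2 * #|permuting_pairs G|%:R.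

(* Main.v *)
Require Import Defs.
From mathcomp Require Import all_boot all_order all_algebra all_fingroup all_solvable.

(* Let X = <x> be the cyclic subgroup of index 2. Its n subgroups are normal in
   G, so they permute with everything. Each of the 2^(n-1) elements outside X
   has order 4, which gives 2^(n-2) further cyclic subgroups. If s and t = us
   lie outside X, then <s><t> is a group of order at most 8 as soon as <s> and
   <t> permute, so t normalizes <s>; as s^t = u^2 s, this forces u^2 into <s>,
   hence u^4 = 1. Writing w for the element of X of order 4, the only such
   subgroups are <s> and <ws>, so <s> permutes with n + 2 cyclic subgroups. *)

Import GRing.Theory.

Local Open Scope ring_scope.

(** * Subgroups of a cyclic p-group; counting permuting pairs fibrewise *)

Section CyclicSubgroups.

Set Implicit Arguments.
Unset Strict Implicit.

Local Open Scope nat_scope.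
Local Open Scope group_scope.

(** A cyclic group has one subgroup per divisor of its order; here [i] in ['I_k.+1] indexes the one
    of order [p ^ (k - i)]. *)
Lemma card_subgroups_cycle_pgroup (gT : finGroupType) (x : gT) (p k : nat) :
  prime p -> #[x] = (p ^ k)%N ->
  #|[set H : {group gT} | H \subset <[x]>]| = k.+1.
Proof.
move=> p_pr ox.
have oxp (i : 'I_k.+1) : #|<[x ^+ (p ^ i)]>| = (p ^ (k - i))%N.
  by rewrite -orderE (orderXexp _ ox).
rewrite -[RHS]card_ord -cardsT.
rewrite -(card_imset _ (f := fun i : 'I_k.+1 => <[x ^+ (p ^ i)]>%G)).
  apply: eq_card => H; rewrite inE; apply/idP/imsetP => [sHx | [i _ ->]].
    have /(dvdn_pfactor _ _ p_pr) [m le_m_k oH]: #|H| %| p ^ k.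
      by rewrite -ox cardSg.
    have lt_mk: k - m < k.+1 by rewrite ltnS leq_subr.
    exists (Ordinal lt_mk) => //; apply/eqP; rewrite -val_eqE /=.
    rewrite (eq_subG_cyclic (cycle_cyclic x)) // ?cycle_subG ?mem_cycle //.
    by rewrite oH (oxp (Ordinal lt_mk)) /= subKn.
  by rewrite cycle_subG mem_cycle.
move=> i j /(congr1 (fun H : {group gT} => #|H|)) /=; rewrite !oxp => /eqP.
rewrite eqn_exp2l ?prime_gt1 // => /eqP eq_ij; apply: val_inj => /=.
by rewrite -(subKn (leq_ord i)) eq_ij subKn ?leq_ord.
Qed.

Lemma card_permuting_pairsE (gT : finGroupType) (G : {group gT}) :
  #|permuting_pairs G| =
    (\sum_(H in cyclic_subgroups G)
       #|[set K in cyclic_subgroups G | (H * K == K * H :> {set gT})%g]|)%N.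
Proof.
under eq_bigr do rewrite -sum1_card.
rewrite pair_big_dep /= sum1dep_card; apply: eq_card => -[H K].
by rewrite !inE /= -!andbA.
Qed.

End CyclicSubgroups.

(** * Conjugation outside X and the permutability criterion *)

Section Quaternion.

Set Implicit Arguments.
Unset Strict Implicit.

Local Open Scope nat_scope.
Local Open Scope group_scope.

Variables (gT : finGroupType) (G : {group gT}) (n : nat) (x : gT).
Hypotheses (n_gt2 : n > 2) (oG : #|G| = (2 ^ n)%N) (Gx : x \in G).
Hypothesis ox : #[x] = (2 ^ n.-1)%N.
Hypothesis oX' : {in G :\: <[x]>, forall t, #[t] = 4}.
Hypothesis invXX' : {in <[x]> & G :\: <[x]>, forall u t, u ^ t = u^-1}.
Hypothesis involG : forall u, u \in G -> #[u] = 2 -> u = x ^+ (2 ^ n.-2).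

Let w := x ^+ (2 ^ (n - 3)).

Let ow : #[w] = 4.
Proof.
rewrite (orderXexp _ ox) -[4]/(2 ^ 2)%N; congr (_ ^ _)%N.
by rewrite -{1}(subnKC n_gt2) /= addnK.
Qed.

Let w2 : w ^+ 2 = x ^+ (2 ^ n.-2).
Proof. by rewrite -expgM -expnSr -(subnKC n_gt2) /= addKn. Qed.

Let Xw : w \in <[x]>. Proof. exact: mem_cycle. Qed.

Let sXG : <[x]> \subset G. Proof. by rewrite cycle_subG. Qed.

Let oG_X : #|G : <[x]>| = 2.
Proof.
by rewrite -divgS // oG -orderE ox -expnB ?leq_pred // -(subnKC n_gt2) /= subSnn.
Qed.

(** As [t] has order 4, its square is an involution, and [G] has only one. *)
Let sqX' t : t \in G :\: <[x]> -> t ^+ 2 = w ^+ 2.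
Proof.
move=> X't; rewrite w2; apply: involG; first by case/setDP: X't => Gt _; rewrite groupX.
by rewrite orderXdiv oX'.
Qed.

Let mulXX' u t : u \in <[x]> -> t \in G :\: <[x]> -> u * t \in G :\: <[x]>.
Proof.
by move=> Xu /setDP[Gt X't]; rewrite inE groupMl // X't groupM // (subsetP sXG).
Qed.

Let invX' t : t \in G :\: <[x]> -> t^-1 = w ^+ 2 * t.
Proof.
move=> X't; apply/eqP.
by rewrite eq_invg_mul -(sqX' X't) -expgSr -expgS -order_dvdn oX'.
Qed.

Let mulX'X u t : u \in <[x]> -> t \in G :\: <[x]> -> t * u = u^-1 * t.
Proof. by move=> Xu X't; rewrite [RHS]conjgC invXX' ?groupV // invgK. Qed.

(** Conjugating by [u] turns [t] into [u ^- 2 * t]; conjugating by [t] then inverts the first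
    factor. *)
Let conjX'M u t : u \in <[x]> -> t \in G :\: <[x]> -> t ^ (u * t) = u ^+ 2 * t.
Proof.
move=> Xu X't; have ->: u ^+ 2 = (u^-1 * u^-1) ^ t.
  by rewrite conjMg !invXX' ?groupV // invgK.
by rewrite conjgM (conjgE t u) (mulX'X Xu X't) mulgA conjMg (conjgE t t) mulKg.
Qed.

(** Hence [w] normalizes [<[t]>], which is why [<[w * t]>] permutes with it. *)
Let conjX'w t : t \in G :\: <[x]> -> t ^ w = t^-1.
Proof.
move=> X't; rewrite conjgE (mulX'X Xw X't) mulgA -invMg -[w * w]/(w ^+ 2) -(sqX' X't).
by rewrite expgS invMg mulgKV.
Qed.

(** The order of [u] divides 4; were it 4, [u] would generate [<[t]>] and [t] would lie in X. *)
Let cycle_capX t u : t \in G :\: <[x]> -> u \in <[t]> -> u \in <[x]> -> u ^+ 2 = 1.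
Proof.
move=> X't tu Xu; apply/eqP; rewrite -order_dvdn.
have: #[u] %| 2 ^ 2 by rewrite -[(2 ^ 2)%N]/4 -(oX' X't) order_dvdG.
case/(dvdn_pfactor _ _ (isT : prime 2)) => -[|[|[|//]]] _ ou; rewrite ?ou //.
case/setDP: (X't) => _ /negP[]; rewrite -cycle_subG.
suffices /eqP <-: <[u]> == <[t]> by rewrite cycle_subG.
by rewrite eqEcard cycle_subG tu -!orderE ou oX'.
Qed.

Let w_notin_cycleX' t : t \in G :\: <[x]> -> w \notin <[t]>.
Proof.
move=> X't; apply/negP => /(cycle_capX X't)/(_ Xw)/eqP.
by rewrite -order_dvdn ow.
Qed.

Let cyclesX'_permute s t : s \in G :\: <[x]> -> t \in G :\: <[x]> ->
  (<[s]> * <[t]> == <[t]> * <[s]>)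
    = (<[t]> == <[s]>) || (<[t]> == <[w * s]>).
Proof.
move=> X's X't; apply/eqP/orP => [cst | [/eqP-> // | /eqP->]]; last first.
  apply/esym/normC; rewrite cycle_subG groupM //; last first.
    by rewrite (subsetP (normG _)) ?cycle_id.
  by apply/normP; rewrite -cycleJ conjX'w ?cycleV.
have Xu: t * s^-1 \in <[x]>.
  by rewrite -mem_rcoset (rcoset_index2 sXG) // oG_X.
set u := t * s^-1 in Xu; have def_t: t = u * s by rewrite mulgKV.
have nst: s ^ t \in <[s]>.
  (* Both cycles contain the involution [w ^+ 2]. *)
  have card_I: 2 <= #|<[s]> :&: <[t]>|.
    rewrite cardG_gt1; apply/trivgPn; exists (w ^+ 2); last by rewrite -order_dvdn ow.
    by rewrite inE -{1}(sqX' X's) -(sqX' X't) !mem_cycle.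
  have sSM : <[s]> \subset <[s]> <*> <[t]> by rewrite joing_subl.
  have card_M := mul_cardG <[s]> <[t]>.
  rewrite -comm_joingE // -!orderE !oX' // in card_M.
  (* The product formula reads 4 * 4 = (4 * index) * |intersection|, with an intersection of order
     at least 2. *)
  have iM: #|<[s]> <*> <[t]> : <[s]>| <= 2.
    have := Lagrange sSM; rewrite -orderE oX' // => oM; rewrite -oM in card_M.
    rewrite -(leq_pmul2r (isT : 0 < 2)).
    apply: leq_trans (leq_mul (leqnn _) card_I) _.
    by rewrite -(leq_pmul2l (isT : 0 < 4)) mulnA -card_M.
  have: <[s]> <| <[s]> <*> <[t]>.
    have := indexg_gt0 (<[s]> <*> <[t]>) <[s]>.
    case i_eq: #|_ : _| iM => [|[|[|//]]] // _ _; last exact: index2_normal.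
    move/eqP: i_eq; rewrite indexg_eq1 => sMS.
    by rewrite /normal sSM (subset_trans sMS) ?normG.
  case/andP=> _ nMs; rewrite memJ_norm ?cycle_id // (subsetP nMs) //.
  by rewrite -cycle_subG joing_subr.
have: u \in <[w]>.
  have u2s : u ^+ 2 \in <[s]>.
    by rewrite -(groupMr _ (cycle_id s)) -conjX'M // -def_t.
  (* In the cyclic group X, inclusion of subgroups amounts to divisibility of orders, so
     [u ^+ 4 = 1] suffices. *)
  rewrite -cycle_subG -(cardSg_cyclic (cycle_cyclic x)) ?cycle_subG //.
  rewrite -!orderE ow order_dvdn -[4]/(2 * 2)%N expgM.
  by rewrite (cycle_capX X's u2s (groupX 2 Xu)).
(* The powers 1, [w], [w ^+ 2], [w ^+ 3] make [t] equal to [s], [w * s], [s^-1], [(w * s)^-1]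
   respectively. *)
rewrite cycle_traject ow !inE => /or4P[] /eqP def_u; rewrite def_t def_u /= ?mulg1.
- by rewrite mul1g; left.
- by right.
- by left; rewrite -[w * w]/(w ^+ 2) -invX' // cycleV.
by right; rewrite mulgA -[w * w]/(w ^+ 2) -mulgA -invX' ?mulXX' // cycleV.
Qed.

(** * Counting cyclic subgroups inside and outside X *)

Let L1 := cyclic_subgroups G.
Let S1 := [set H : {group gT} | H \subset <[x]>].

Let L1E H : (H \in L1) = (H \subset G) && cyclic H.
Proof. by rewrite !inE. Qed.

Let sS1L1 : S1 \subset L1.
Proof.
apply/subsetP=> H; rewrite inE L1E => sHX.
by rewrite (subset_trans sHX) // (cyclicS sHX) ?cycle_cyclic.
Qed.

Let cardS1 : #|S1| = n.
Proof.
rewrite (card_subgroups_cycle_pgroup (isT : prime 2) ox).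
by rewrite prednK // (ltn_trans _ n_gt2).
Qed.

Let L1_X'P H :
  reflect (exists2 t, t \in G :\: <[x]> & H = <[t]>%G) (H \in L1 :\: S1).
Proof.
rewrite in_setD L1E inE.
apply: (iffP and3P) => [[nsHX sHG /cyclicP[t defH]] | [t X't ->]].
  exists t; last exact: val_inj.
  by rewrite inE -!cycle_subG -defH nsHX.
by case/setDP: X't => Gt X't; rewrite /= !cycle_subG cycle_cyclic.
Qed.

(** Sort the elements outside X by the cycle they generate: each class consists of the [totient 4] =
    2 generators of one cycle. *)
Let card_L1_X' : #|L1 :\: S1| = (2 ^ n.-2)%N.
Proof.
have card_X' : #|G :\: <[x]>| = (2 ^ n.-1)%N.
  rewrite cardsD (setIidPr sXG) oG -orderE ox -(ltn_predK n_gt2) expnS /=.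
  by rewrite mul2n -addnn addnK.
apply/eqP; rewrite -(eqn_pmul2r (isT : 0 < 2)) -expnSr.
have -> : n.-2.+1 = n.-1 by rewrite -(subnKC n_gt2).
rewrite -card_X' -sum_nat_const -[X in _ == X]sum1_card.
rewrite (partition_big (fun t => <[t]>%G) [in L1 :\: S1]) /=; last first.
  by move=> t X't; apply/L1_X'P; exists t.
apply/eqP/eq_bigr => _ /L1_X'P[t X't ->]; rewrite sum1dep_card.
rewrite -[2]/(totient 4) -(oX' X't) totient_gen; apply: eq_card => s.
rewrite !inE /generator -val_eqE /= [RHS]andb_idl; first by rewrite eq_sym.
move/eqP/(congr1 val) => /= eq_st; move: X't; rewrite !inE -!cycle_subG.
by rewrite eq_st.
Qed.

Let cardL1 : #|L1| = (n + 2 ^ n.-2)%N.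
Proof.
by rewrite -card_L1_X' -cardS1 -(cardsID S1 L1) (setIidPr sS1L1).
Qed.

(** [H] is characteristic in the cyclic group X, itself normal as it has index 2. *)
Let S1_permute H K : H \in S1 -> K \in L1 -> H * K = K * H :> {set gT}.
Proof.
rewrite inE L1E => sHX /andP[sKG _]; apply/esym/normC.
apply: subset_trans sKG _; apply: char_norm_trans (cycle_subgroup_char sHX) _.
by apply: normal_norm; apply: index2_normal.
Qed.

Let card_permuting_S1 H : H \in S1 ->
  #|[set K in L1 | (H * K == K * H :> {set gT})%g]| = (n + 2 ^ n.-2)%N.
Proof.
move=> S1H; rewrite -cardL1; apply: eq_card => K; rewrite inE andb_idr // => L1K.
by rewrite S1_permute.
Qed.

Let card_permuting_X' H : H \in L1 :\: S1 ->
  #|[set K in L1 | (H * K == K * H :> {set gT})%g]| = n.+2.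
Proof.
move=> L1_H; have [/setDP[L1H _] [s X's def_H]] := (L1_H, L1_X'P _ L1_H).
rewrite {}def_H in L1H *; have X'ws := mulXX' Xw X's.
rewrite -(cardsID S1) -[n.+2]addn2; congr (_ + _)%N.
  rewrite -cardS1; apply: eq_card => K; rewrite in_setI andb_idl // => S1K.
  by rewrite inE (subsetP sS1L1) // eq_sym (S1_permute S1K L1H) /=.
(* If they coincided, [<[s]>] would contain [w]. *)
have ne_s_ws : <[s]>%G != <[w * s]>%G.
  rewrite -val_eqE /=; apply: contra (w_notin_cycleX' X's) => /eqP eq_s_ws.
  have: w * s \in <[s]> by rewrite eq_s_ws cycle_id.
  by rewrite groupMr ?cycle_id.
have -> : 2 = #|[set <[s]>%G; <[w * s]>%G]| by rewrite cards2 ne_s_ws.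
apply: eq_card => K; apply/setDP/set2P => [[] | eqK].
  rewrite inE => /andP[L1K perm_sK] notS1K.
  have /L1_X'P[t X't def_K] : K \in L1 :\: S1 by rewrite inE notS1K.
  move: perm_sK; rewrite def_K cyclesX'_permute //.
  by case/orP=> /eqP eq_t; [left | right]; apply: val_inj.
have [t X't defK] : exists2 t, t \in G :\: <[x]> & K = <[t]>%G.
  by case: eqK => ->; [exists s | exists (w * s)].
have /setDP[L1K notS1K] : K \in L1 :\: S1 by apply/L1_X'P; exists t.
split=> //; rewrite inE L1K defK cyclesX'_permute //.
by case: eqK; rewrite defK => /(congr1 val) /= ->; rewrite eqxx ?orbT.
Qed.

Lemma card_cyclic_subgroups_quaternion :
  #|cyclic_subgroups G| = (n + 2 ^ (n - 2))%N.
Proof. by rewrite -/L1 cardL1 subn2. Qed.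

Lemma card_permuting_pairs_quaternion :
  #|permuting_pairs G| = (n ^ 2 + n.+1 * 2 ^ (n - 1))%N.
Proof.
rewrite card_permuting_pairsE (big_setID S1) /= (setIidPr sS1L1).
rewrite (eq_bigr _ card_permuting_S1) (eq_bigr _ card_permuting_X').
rewrite !sum_nat_const cardS1 card_L1_X' subn1.
have -> : n.-1 = n.-2.+1 by rewrite -(subnKC n_gt2).
(* With q = [2 ^ n.-2], the total is n(n + q) + q(n + 2) = n^2 + (n + 1)(2q). *)
rewrite (expnS 2) mulnDr -addnA mulnn; congr (_ + _)%N.
by rewrite [X in _ + X]mulnC -mulnDl mulnA muln2 -addnn addSnnS.
Qed.

End Quaternion.

Lemma csd_quaternion (n : nat) (gT : finGroupType) (G : {group gT}) :
  (3 <= n)%N -> (G \isog 'Q_(2 ^ n))%g ->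
  csd G = (n%:R ^+ 2 + (n%:R + 1) * 2%:R ^+ (n - 1))
            / (n%:R + 2%:R ^+ (n - 2)) ^+ 2.
Proof.
move=> n_gt2 isoG.
have [[x y] genG _] := generators_quaternion n_gt2 isoG.
(* Elements outside X have order 4 and invert X, and the involution is unique. *)
have [[_ oX' invXX'] _ [_ _ involG _ _] _ _] :=
  quaternion_structure n_gt2 genG isoG.
have [oG Gx ox _] := genG.
rewrite /csd (card_cyclic_subgroups_quaternion n_gt2 oG Gx ox oX').
rewrite (card_permuting_pairs_quaternion n_gt2 oG Gx ox oX' invXX' involG).
by rewrite div1r mulrC (natrD _ n) natrD (natrX _ n 2) (natrM _ n.+1) !natrX natr1.
Qed.

Theorem theorem3p3p1 :
  (forall (n : nat) (gT : finGroupType) (G : {group gT}),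
     (3 <= n)%N -> (G \isog 'Q_(2 ^ n))%g ->
     csd G = (n%:R ^+ 2 + (n%:R + 1) * 2%:R ^+ (n - 1))
               / (n%:R + 2%:R ^+ (n - 2)) ^+ 2)
  /\
  (forall (gT : finGroupType) (G : {group gT}),
     (G \isog 'Q_16)%g -> csd G = 7%:R / 8%:R).
Proof.
split=> [n gT G n_gt2|gT G isoG]; first exact: csd_quaternion.
(* At n = 4 the formula evaluates to 56/64. *)
by rewrite (csd_quaternion (n := 4) _ isoG).
Qed.
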